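(* For every $n\in\mathbb{N}_0$, every $\lambda\in\mathbb{N}$, and each $\mu\in\{0,\dots,\lambda\}$, we have $$OP_{\Pi_n,\operatorname{Aut}(\Pi_n)}(\lambda,\mu)=\frac12\left(P_{\Pi_n}(\lambda,\mu)+P_{\Pi_{n/2}}(\lambda,\mu)\right)$$ if $n$ is even, and $$OP_{\Pi_n,\operatorname{Aut}(\Pi_n)}(\lambda,\mu)=\frac12\left(P_{\Pi_n}(\lambda,\mu)+(\lambda-\mu)\,P_{\Pi_{(n-3)/2}}(\lambda,\mu)\right)$$ if $n$ is odd, where $\Pi_{-1}$ is considered as the empty graph.
   Context: $\mathbb{N}$ denotes the positive integers and $\mathbb{N}_0=\mathbb{N}\cup\{0\}$. $\Pi_n$ is the path of length $n$, with vertex set $\{0,\dots,n\}$ and edge set $\{\{v,v+1\}\mid v=0,\dots,n-1\}$. $\operatorname{Aut}(\Gamma)$ is the automorphism group of a graph $\Gamma$, viewed as a group of permutations of the vertices. A $\lambda$-coloring of $\Gamma$ is a map $f$ from the vertex set of $\Gamma$ to $\{1,\dots,\lambda\}$; it is $\mu$-proper if for every pair of adjacent vertices $v,w$, either $f(v)\ne f(w)$ or $f(v)=f(w)>\mu$. $P_\Gamma(\lambda,\mu)$ is the number of $\mu$-proper $\lambda$-colorings of $\Gamma$ (so it equals $1$ for the empty graph). For a subgroup $G$ of $\operatorname{Aut}(\Gamma)$, $OP_{\Gamma,G}(\lambda,\mu)$ is the number of equivalence classes of $\mu$-proper $\lambda$-colorings of $\Gamma$, where $f$ and $f'$ are equivalent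 if $f'=f\circ g$ for some $g\in G$. *)

(* Defs.v *)
From HB Require Import structures.
From mathcomp Require Import all_boot all_order all_algebra all_fingroup.

Set Implicit Arguments.
Unset Strict Implicit.
Unset Printing Implicit Defensive.

Record sgraph (V : finType) := SGraph {
  adj : rel V;
  adj_sym : symmetric adj;
  adj_irrefl : irreflexive adj }.

Definition Aut_graph (V : finType) (Gamma : sgraph V) : {set {perm V}} :=
  [set g : {perm V} |
    [forall v, forall w, adj Gamma (g v) (g w) == adj Gamma v w]].

Lemma Aut_graph_group_set (V : finType) (Gamma : sgraph V) :
  group_set (Aut_graph Gamma).
Proof.
apply/group_setP; split.
  by rewrite inE; apply/forallP => v; apply/forallP => w; rewrite !perm1.
move=> g h; rewrite !inE => /forallP Hg /forallP Hh.
apply/forallP => v; apply/forallP => w; rewrite !permM.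
by rewrite (eqP (forallP (Hh _) _)) (eqP (forallP (Hg _) _)).
Qed.

Canonical Aut_graph_group (V : finType) (Gamma : sgraph V) :=
  Group (Aut_graph_group_set Gamma).

(* The colors {1, ..., lambda} are encoded by 'I_lambda: the index i stands
   for the color i.+1. *)
Definition coloring (V : finType) (lambda : nat) := {ffun V -> 'I_lambda}.

Definition color (lambda : nat) (i : 'I_lambda) : nat := i.+1.

Definition mu_proper (V : finType) (Gamma : sgraph V) (lambda mu : nat)
    (f : coloring V lambda) : bool :=
  [forall v, forall w, adj Gamma v w ==>
     ((f v != f w) || (f v == f w) && (mu < color (f v)))].

Definition proper_colorings (V : finType) (Gamma : sgraph V)
    (lambda mu : nat) : {set coloring V lambda} :=
  [set f : coloring V lambda | mu_proper Gamma mu f].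

Definition P (V : finType) (Gamma : sgraph V) (lambda mu : nat) : nat :=
  #|proper_colorings Gamma lambda mu|.

Definition coloring_equiv (V : finType) (G : {group {perm V}}) (lambda : nat) :
    rel (coloring V lambda) :=
  fun f f' => [exists g in G, f' == [ffun v => f (g v)]].

Definition OP (V : finType) (Gamma : sgraph V) (G : {group {perm V}})
    (lambda mu : nat) : nat :=
  #|equivalence_partition (@coloring_equiv V G lambda)
      (proper_colorings Gamma lambda mu)|.

(* The path of length z has z + 1 vertices; indexing by int makes room for
   the empty graph as the path of length -1. *)
Definition path_order (z : int) : nat :=
  match z with Posz n => n.+1 | Negz _ => 0 end.

Definition path_adj (k : nat) : rel 'I_k :=
  [rel v w : 'I_k | (w == v.+1 :> nat) || (v == w.+1 :> nat)].

Lemma path_adj_sym (k : nat) : symmetric (@path_adj k).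
Proof. by move=> v w; rewrite /path_adj /= orbC. Qed.

Lemma path_adj_irrefl (k : nat) : irreflexive (@path_adj k).
Proof. by move=> v; rewrite /path_adj /= orbb; apply: ltn_eqF. Qed.

Definition Pi (z : int) : sgraph 'I_(path_order z) :=
  SGraph (@path_adj_sym (path_order z)) (@path_adj_irrefl (path_order z)).

(* Main.v *)
(** An automorphism of a path moves by one step at each step and never
    backtracks, so it is the identity or the reversal.  Counting the orbits of
    an involution gives twice the number of classes as the number of proper
    colorings plus the number of palindromic ones.  A palindromic coloring is
    determined by its first half; on a path with an even number of vertices,
    the two central vertices share a color, which must exceed mu and is
    otherwise unconstrained. *)

Require Import Defs.
From HB Require Import structures.
From mathcomp Require Import all_boot all_order all_algebra all_fingroup.
From mathcomp Require Import zify ring.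

Set Implicit Arguments.
Unset Strict Implicit.
Unset Printing Implicit Defensive.

Import Order.TTheory GRing.Theory Num.Theory.
Local Open Scope ring_scope.

(** * Counting the orbits of an involution *)

(** Each class contributes 2 to the right-hand side: either two elements and no fixed point, or a
    single element that is also a fixed point. *)
Lemma double_card_involution_classes (T : finType) (r : T -> T) (e : rel T)
    (S : {set T}) :
  involutive r -> {in S, forall x, r x \in S} ->
  (forall x y, e x y = (y == x) || (y == r x)) ->
  (#|equivalence_partition e S|.*2 = #|S| + #|[set x in S | r x == x]|)%N.
Proof.
move=> rK rS eE.
have eqv : {in S & &, equivalence_rel e}.
  move=> x y z _ _ _; split; first by rewrite eE eqxx.
  rewrite !eE => /orP[] /eqP -> //.
  by rewrite rK orbC.
have partS := equivalence_partitionP eqv.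
(* As a sum of indicators, the fixed-point count can be merged with [#|S|] and then split along the
   classes. *)
have -> : (#|[set x in S | r x == x]| = \sum_(x in S) (r x == x))%N.
  rewrite -sum1_card big_mkcond [RHS]big_mkcond /=; apply: eq_bigr => x _.
  by rewrite inE; case: (x \in S); case: (r x == x).
rewrite -[#|S|]sum1_card -big_split /= -[in RHS](cover_partition partS).
rewrite big_trivIset ?(partition_trivIset partS) //=.
rewrite -muln2 -sum_nat_const; apply: eq_bigr => B /imsetP[x xS ->].
(* Stability of [S] under [r] keeps the whole pair inside the class. *)
have -> : [set y in S | e x y] = [set x; r x].
  apply/setP=> y; rewrite !inE eE andb_idl //.
  by case/orP=> /eqP-> //; apply: rS.
have [rx|rx] := eqVneq (r x) x.
  by rewrite rx setUid big_set1 rx eqxx.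
rewrite big_setU1 ?big_set1 ?inE /= ?rK; last by rewrite eq_sym.
by rewrite [x == r x]eq_sym (negPf rx).
Qed.

(** * Paths and their automorphisms *)

(** Indexed by the number of vertices: [Pi n] is [path_graph n.+1] by computation, and the empty
    graph is [path_graph 0]. *)
Definition path_graph (k : nat) : sgraph 'I_k :=
  SGraph (@path_adj_sym k) (@path_adj_irrefl k).

(** By symmetry each edge need only be read upwards. The index [f v] stands for the color
    [(f v).+1], so exceeding [mu] becomes [mu <= f v]. *)
Lemma path_properP (k lambda mu : nat) (f : coloring 'I_k lambda) :
  reflect (forall v w : 'I_k, w = v.+1 :> nat -> f v = f w -> (mu <= f v)%N)
          (mu_proper (path_graph k) mu f).
Proof.
apply: (iffP forallP) => [H v w vw fvw | H v].
  have /forallP/(_ w)/implyP := H v.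
  by rewrite /= /path_adj /= vw eqxx fvw eqxx /= => /(_ isT).
apply/forallP => w; apply/implyP => /= /orP[] /eqP vw.
  by case: eqVneq => //= fvw; apply: H vw fvw.
by case: eqVneq => //= fvw; rewrite fvw /color; apply: H vw _.
Qed.

Definition rev_perm (k : nat) : {perm 'I_k} := perm (@rev_ord_inj k).

Lemma rev_perm_Aut (k : nat) : rev_perm k \in Aut_graph (path_graph k).
Proof.
rewrite inE; apply/forallP => v; apply/forallP => w; apply/eqP.
rewrite !permE /= /path_adj /=; have := ltn_ord v; have := ltn_ord w; lia.
Qed.

(** A change of direction would give [h i.+2 = h i], so the first step decides the direction of all
    the others. *)
Lemma unit_steps_monotone (n : nat) (h : nat -> nat) :
  (forall i, (i < n)%N -> h i.+1 = (h i).+1 \/ h i = (h i.+1).+1) ->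
  (forall i, (i.+1 < n)%N -> h i.+2 <> h i) ->
  (forall i, (i <= n)%N -> h i = h 0 + i)%N \/
  (forall i, (i <= n)%N -> h i + i = h 0)%N.
Proof.
move=> step inj; case: n step inj => [|n] step inj.
  by left=> i; rewrite leqn0 => /eqP->; rewrite addn0.
have [up|down] := step 0 isT; [left | right].
- have upS i : (i < n.+1)%N -> h i.+1 = (h i).+1.
    elim: i => // i IH lt_i; have := IH (ltnW lt_i).
    have := step _ lt_i; have := inj _ lt_i; lia.
  by elim=> [|i IH] lt_i; rewrite ?addn0 // upS // IH ?addnS // ltnW.
- have downS i : (i < n.+1)%N -> h i = (h i.+1).+1.
    elim: i => // i IH lt_i; have := IH (ltnW lt_i).
    have := step _ lt_i; have := inj _ lt_i; lia.
  by elim=> [|i IH] lt_i; rewrite ?addn0 // addnS -addSn -downS // IH // ltnW.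
Qed.

Lemma Aut_path (n : nat) (g : {perm 'I_n.+1}) :
  g \in Aut_graph (path_graph n.+1) -> g = 1%g \/ g = rev_perm n.+1.
Proof.
rewrite inE => /forallP gA; pose h i : nat := g (inord i).
have hE (v : 'I_n.+1) : h v = g v by rewrite /h inord_val.
have hle i : (h i <= n)%N by rewrite -ltnS; apply: ltn_ord.
(* Preservation of edges gives unit steps; injectivity of [g] forbids backtracking. *)
have [||up|down] := @unit_steps_monotone n h.
- move=> i lt_i; have /forallP/(_ (inord i.+1))/eqP := gA (inord i).
  rewrite /= /path_adj /= !inordK ?ltnS //; last exact: ltnW.
  by rewrite eqxx /= => /orP[]/eqP; [left | right].
- move=> i lt_i /val_inj/perm_inj/(congr1 (@nat_of_ord _)).
  by rewrite !inordK ?ltnS //; lia.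
(* All values lie in 0..n, so a rise by n must start at 0 and, in the other case, a fall by n must
   start at n. *)
- left; apply/permP=> v; apply/val_inj; rewrite perm1 /= -hE.
  have := up _ (leqnn n); have := hle n; have := up v (ltn_ord v); lia.
- right; apply/permP=> v; apply/val_inj; rewrite permE /= -hE.
  have := down _ (leqnn n); have := hle 0%N; have := down v (ltn_ord v); lia.
Qed.

(** * Reversal of colorings and the orbit count *)

Definition rev_coloring (k lambda : nat) (f : coloring 'I_k lambda) :
  coloring 'I_k lambda := [ffun v => f (rev_ord v)].

Lemma rev_coloringK (k lambda : nat) : involutive (@rev_coloring k lambda).
Proof. by move=> f; apply/ffunP=> v; rewrite !ffunE rev_ordK. Qed.

Lemma rev_coloring_proper (k lambda mu : nat) (f : coloring 'I_k lambda) :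
  mu_proper (path_graph k) mu f ->
  mu_proper (path_graph k) mu (rev_coloring f).
Proof.
move/path_properP=> fP; apply/path_properP=> v w vw; rewrite !ffunE => fvw.
rewrite fvw; apply: (fP _ (rev_ord v)) => //=.
by have := ltn_ord w; lia.
Qed.

Lemma coloring_equiv_path (n lambda : nat) (f f' : coloring 'I_n.+1 lambda) :
  coloring_equiv (Aut_graph_group (path_graph n.+1)) f f' =
  (f' == f) || (f' == rev_coloring f).
Proof.
have rE : [ffun v => f (rev_perm n.+1 v)] = rev_coloring f.
  by apply/ffunP=> v; rewrite !ffunE permE.
have oE : [ffun v => f ((1%g : {perm 'I_n.+1}) v)] = f.
  by apply/ffunP=> v; rewrite ffunE perm1.
apply/exists_inP/orP=> [[g /Aut_path[]-> /eqP->]|[]/eqP->].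
- by left; rewrite oE.
- by right; rewrite rE.
- by exists 1%g; rewrite ?group1 ?oE.
- by exists (rev_perm n.+1); rewrite ?rev_perm_Aut ?rE.
Qed.

Definition palindromic_colorings (k lambda mu : nat) :
    {set coloring 'I_k lambda} :=
  [set f in proper_colorings (path_graph k) lambda mu | rev_coloring f == f].

Lemma OP_path (n lambda mu : nat) :
  ((OP (Pi n) (Aut_graph_group (Pi n)) lambda mu).*2 =
   P (Pi n) lambda mu + #|palindromic_colorings n.+1 lambda mu|)%N.
Proof.
apply: double_card_involution_classes.
- exact: rev_coloringK.
- by move=> f; rewrite !inE; apply: rev_coloring_proper.
- exact: coloring_equiv_path.
Qed.

(** * Counting palindromic colorings *)

Lemma palindromicP (k lambda mu : nat) (f : coloring 'I_k lambda) :
  reflect (mu_proper (path_graph k) mu f /\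
           forall v w : 'I_k, (v + w).+1 = k -> f v = f w)
          (f \in palindromic_colorings k lambda mu).
Proof.
rewrite !inE; apply: (iffP andP) => -[fP fr]; split=> //.
  move=> v w vw; rewrite -{1}(eqP fr) ffunE; congr (f _).
  by apply: val_inj => /=; lia.
apply/eqP/ffunP=> v; rewrite ffunE; apply: fr => /=.
have := ltn_ord v; lia.
Qed.

(** Restriction to the vertices 0..m is inverted by folding the path at its center m, which sends
    [v] to [minn v (m.*2 - v)]. *)
Lemma card_palindromic_odd (m lambda mu : nat) :
  #|palindromic_colorings m.*2.+1 lambda mu| =
  #|proper_colorings (path_graph m.+1) lambda mu|.
Proof.
pose F (g : coloring 'I_m.+1 lambda) : coloring 'I_m.*2.+1 lambda :=
  [ffun v : 'I_m.*2.+1 => g (inord (minn v (m.*2 - v)))].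
pose G (f : coloring 'I_m.*2.+1 lambda) : coloring 'I_m.+1 lambda :=
  [ffun v : 'I_m.+1 => f (inord v)].
have FK : cancel F G.
  move=> g; apply/ffunP=> v; rewrite !ffunE; congr (g _).
  by apply: val_inj; rewrite /= !inordK //; have := ltn_ord v; lia.
rewrite -(card_imset _ (can_inj FK)); congr #|pred_of_set _|.
apply/setP=> f; apply/palindromicP/imsetP => [[/path_properP fP fr]|[g]].
  exists (G f).
    rewrite inE; apply/path_properP=> v w vw; rewrite !ffunE.
    by apply: fP; rewrite !inordK //; have := ltn_ord v; have := ltn_ord w; lia.
  apply/ffunP=> v; rewrite !ffunE; have lt_v := ltn_ord v.
  have [le_v|gt_v] := leqP v m.
    congr (f _); apply: val_inj; rewrite /= !inordK //; lia.
  by apply: fr; rewrite !inordK; lia.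
rewrite inE => /path_properP gP ->; split; last first.
  by move=> v w vw; rewrite !ffunE; congr (g (inord _)); lia.
apply/path_properP=> v w vw; rewrite !ffunE => gvw.
have lt_w := ltn_ord w.
(* Left of the center the fold keeps the direction of an edge; to the right it reverses it, so [gP]
   is applied to the mirrored edge. *)
have [lt_v|ge_v] := ltnP v m.
  by apply: (gP _ (inord (minn w (m.*2 - w)))); rewrite // !inordK; lia.
rewrite gvw.
by apply: (gP _ (inord (minn v (m.*2 - v)))); rewrite // !inordK; lia.
Qed.

Lemma card_ord_geq (lambda mu : nat) :
  #|[set c : 'I_lambda | (mu <= c)%N]| = (lambda - mu)%N.
Proof.
rewrite -sum1_card (eq_bigl (fun c : 'I_lambda => mu <= c)%N); last first.
  by move=> c; rewrite inE.
have [le|lt] := leqP mu lambda; last first.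
  rewrite big1 => [|c le_c]; first lia.
  by have := ltn_ord c; lia.
rewrite -(big_mkord (fun i => mu <= i)%N (fun=> 1%N)).
rewrite (big_cat_nat (leq0n mu) le) /=.
rewrite big_nat_cond big_pred0 => [|i]; last by lia.
rewrite big_nat_cond (eq_bigl (fun i => (mu <= i < lambda)%N)) => [|i] /=.
  by rewrite -big_nat sum_nat_const_nat; lia.
lia.
Qed.

(* A pair (g, c) stands for the coloring g, c, c, g reversed. *)
Lemma card_palindromic_even (m lambda mu : nat) :
  (#|palindromic_colorings m.*2.+2 lambda mu| =
   (lambda - mu) * #|proper_colorings (path_graph m) lambda mu|)%N.
Proof.
pose F (p : coloring 'I_m lambda * 'I_lambda) : coloring 'I_m.*2.+2 lambda :=
  (* At the two central vertices m and m+1 the folded index is m, outside ['I_m]; [insub] then fails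
     and the default [p.2] is the color. *)
  [ffun v : 'I_m.*2.+2 => oapp p.1 p.2 (insub (minn v (m.*2.+1 - v)))].
pose G (f : coloring 'I_m.*2.+2 lambda) : coloring 'I_m lambda * 'I_lambda :=
  ([ffun v : 'I_m => f (inord v)], f (inord m)).
have Flt p (v : 'I_m.*2.+2) (u : 'I_m) :
    u = minn v (m.*2.+1 - v) :> nat -> F p v = p.1 u.
  by move=> uv; rewrite ffunE -uv valK.
have Fmid p (v : 'I_m.*2.+2) : minn v (m.*2.+1 - v) = m -> F p v = p.2.
  by move=> vm; rewrite ffunE vm insubN // ltnn.
have FK : cancel F G.
  move=> [g c]; congr pair; last by rewrite Fmid // inordK; lia.
  apply/ffunP=> v; rewrite ffunE; apply: Flt.
  by have lt_v := ltn_ord v; rewrite inordK; lia.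
rewrite mulnC -card_ord_geq -cardsX -(card_imset _ (can_inj FK)).
congr #|pred_of_set _|.
apply/setP=> f; apply/palindromicP/imsetP => [[/path_properP fP fr]|[[g c]]].
  exists (G f).
    rewrite !inE /=; apply/andP; split.
      apply/path_properP=> v w vw; rewrite !ffunE.
      have lt_w := ltn_ord w; apply: fP.
      by rewrite !inordK //; lia.
    (* The vertices m and m+1 are adjacent and mirror each other, so they share a color, which
       properness forces above [mu]. *)
    apply: (fP _ (inord m.+1)); first by rewrite !inordK; lia.
    by apply: fr; rewrite !inordK; lia.
  apply/ffunP=> v; have lt_v := ltn_ord v.
  have [lt_m|ge_m] := ltnP (minn v (m.*2.+1 - v)) m.
    rewrite (Flt _ _ (Ordinal lt_m)) //= ffunE /=.
    have [le_v|gt_v] := leqP v m.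
      by congr (f _); apply: val_inj; rewrite /= inordK; lia.
    by apply: fr; rewrite inordK; lia.
  rewrite Fmid /=; last by lia.
  have [le_v|gt_v] := leqP v m.
    by congr (f _); apply: val_inj; rewrite /= inordK; lia.
  by apply: fr; rewrite inordK; lia.
rewrite !inE /= => /andP[/path_properP gP le_c] ->; split; last first.
  move=> v w vw; rewrite !ffunE /=.
  by have -> : minn v (m.*2.+1 - v) = minn w (m.*2.+1 - w) by lia.
apply/path_properP=> v w vw; have lt_w := ltn_ord w.
(* An edge touching the center can be monochromatic only in the color [c], which exceeds [mu]; any
   other edge folds to an edge of the half path. *)
have [lt_v|ge_v] := ltnP (minn v (m.*2.+1 - v)) m; last first.
  by rewrite Fmid //; lia.
have [lt_w'|ge_w] := ltnP (minn w (m.*2.+1 - w)) m; last first.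
  by move=> ->; rewrite Fmid //; lia.
rewrite (Flt _ v (Ordinal lt_v)) // (Flt _ w (Ordinal lt_w')) //= => gvw.
have [le_v|gt_v] := leqP v m; first by apply: gP gvw => /=; lia.
by rewrite gvw; apply: gP (esym gvw) => /=; lia.
Qed.

Theorem theorem9 (n lambda mu : nat) (hlambda : (0 < lambda)%N)
    (hmu : (mu <= lambda)%N) :
  (~~ odd n ->
     (OP (Pi n) (Aut_graph_group (Pi n)) lambda mu)%:R =
       1 / 2 * ((P (Pi n) lambda mu)%:R
                + (P (Pi (n %/ 2)%N) lambda mu)%:R) :> rat)
  /\
  (odd n ->
     (OP (Pi n) (Aut_graph_group (Pi n)) lambda mu)%:R =
       1 / 2 * ((P (Pi n) lambda mu)%:R
                + (lambda%:R - mu%:R)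
                  * (P (Pi ((n%:Z - 3) %/ 2)%Z) lambda mu)%:R) :> rat).
Proof.
have half_double (a b : nat) : a.*2 = b -> a%:R = 1 / 2 * b%:R :> rat.
  by move=> <-; rewrite -muln2 natrM; field.
rewrite (half_double _ _ (OP_path n lambda mu)) natrD.
split=> n_par; congr (_ * (_ + _)).
  have [m ->] : exists m, n = m.*2 by exists n./2; lia.
  have -> : (m.*2 %/ 2)%N = m by lia.
  by rewrite card_palindromic_odd.
have [m ->] : exists m, n = m.*2.+1 by exists n./2; lia.
(* The bound [mu <= lambda] makes the truncated difference agree with the rational one. *)
rewrite card_palindromic_even natrM natrB //; congr (_ * _%:R).
have -> : ((m.*2.+1%:Z - 3) %/ 2)%Z = m%:Z - 1 by lia.
(* For n = 1 the index is -1 and both sides count the single coloring of the empty graph. *)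
by case: m => [|m] //; have -> : m.+1%:Z - 1 = m by lia.
Qed.
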